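(* Let $G$ be a finite cyclic group of order $n=p_1^{\alpha_1}p_2^{\alpha_2}\cdots p_r^{\alpha_r}\geq 3$, where the $p_i$ are distinct primes and the $\alpha_i$ are non-negative integers for $1\leq i\leq r$. Let $H\neq\{e\}$ be a subgroup of $G$ and let $\Gamma_{G,H}$ be the generalized non-coprime graph of $G$ with respect to $H$. For positive integers $m$ and $h$ let $\Omega_{m,h}=\{d : d\mid m,\ d>1,\ \gcd(d,h)>1\}$. Then, for every $x\in G\setminus\{e\}$, \[\deg_{\Gamma_{G,H}}(x)=\begin{cases}\left(\sum_{d\in\Omega_{|G|,|x|}}\phi(d)\right)-1 & \text{if } x\in H;\\[4pt] \sum_{d\in\Omega_{|H|,|x|}}\phi(d) & \text{if } x\in G\setminus H.\end{cases}\]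
   Context: For a finite group $G$ with identity $e$ and a subgroup $H\neq\{e\}$ of $G$, the generalized non-coprime graph $\Gamma_{G,H}$ is the simple undirected graph with vertex set $G\setminus\{e\}$ in which two distinct vertices $a,b$ are adjacent if and only if $\gcd(|a|,|b|)\neq 1$ and ($a\in H$ or $b\in H$), where $|a|$ denotes the order of the element $a$. $\phi$ is Euler's totient function. *)

(* Defs.v *)
From mathcomp Require Import all_boot all_order all_algebra all_fingroup all_solvable.

Set Implicit Arguments.
Unset Strict Implicit.
Unset Printing Implicit Defensive.

Local Open Scope nat_scope.

Record sgraph (T : finType) := SGraph {
  vertices : {set T};
  adj : rel T;
  adj_vertices : forall a b, adj a b -> (a \in vertices) && (b \in vertices);
  adj_sym : symmetric adj;
  adj_irrefl : irreflexive adj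
}.

Definition deg (T : finType) (g : sgraph T) (x : T) : nat :=
  #|[set y in vertices g | adj g x y]|.

Section NonCoprimeGraph.

Variables (gT : finGroupType) (G H : {group gT}).

Definition ncadj : rel gT := fun a b =>
  [&& a \in G^#%g, b \in G^#%g, a != b, gcdn #[a]%g #[b]%g != 1
    & (a \in H) || (b \in H)].

Fact ncadj_vertices a b : ncadj a b -> (a \in G^#%g) && (b \in G^#%g).
Proof. by case/and3P=> -> ->. Qed.

Fact ncadj_sym : symmetric ncadj.
Proof.
by move=> a b; rewrite /ncadj andbCA eq_sym gcdnC [(a \in H) || _]orbC.
Qed.

Fact ncadj_irrefl : irreflexive ncadj.
Proof. by move=> a; rewrite /ncadj eqxx !andbF. Qed.

Definition noncoprime_graph : sgraph gT :=
  SGraph ncadj_vertices ncadj_sym ncadj_irrefl.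

End NonCoprimeGraph.

(* For m > 0, [divisors m] is duplicate-free and lists all divisors of m, so
   a sum over this sequence is a sum over the corresponding set. *)
Definition Omega (m h : nat) : seq nat :=
  [seq d <- divisors m | (1 < d) && (1 < gcdn d h)].

(* Main.v *)
Require Import Defs.
From mathcomp Require Import all_boot all_order all_algebra all_fingroup all_solvable.

(** Let x be a vertex; it is nontrivial, so gcdn #[x] #[x] = #[x] > 1.  If x
    lies in H, the condition that one endpoint be in H holds for every y, so
    the neighbours of x are the nontrivial elements of G whose order is not
    coprime to #[x], except x itself, which the count includes: this is the -1
    of the formula.  If x lies outside H, a neighbour must lie in H, and is
    then automatically distinct from x: the neighbours are the nontrivial
    elements of H whose order is not coprime to #[x].

    Up to the removal of x, both sets are cut out of a cyclic group K (K = G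
    or K = H) by a condition on the order of an element.  A cyclic group has exactly one subgroup of
    each order d dividing #|K|, so its elements of order d are the generators
    of that subgroup, and there are totient d of them
    ([card_order_eq_cyclic]).  Sorting by order therefore turns such a
    cardinality into a sum of totients over the divisors of #|K|
    ([card_order_pred_cyclic]). *)

(** By uniqueness of the subgroup of order d, having order d amounts to
    generating the same subgroup as one fixed element of order d. *)
Lemma card_order_eq_cyclic (gT : finGroupType) (K : {group gT}) (d : nat) :
  cyclic K -> d %| #|K| -> #|[set y in K | #[y]%g == d]| = totient d.
Proof.
move=> cycK dK; have [a defK] := cyclicP cycK.
have oK : #|K| = #[a]%g by rewrite defK.
pose z := (a ^+ (#[a] %/ d))%g.
have da : d %| #[a]%g by rewrite -oK.
have oz : #[z]%g = d by rewrite orderXdiv ?dvdn_div // divnA ?mulKn ?order_gt0.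
have Kz : z \in K by rewrite defK mem_cycle.
rewrite -oz totient_gen; apply: eq_card => y; rewrite !inE /generator.
apply/andP/eqP => [[Ky /eqP oy] | eq_zy].
  by apply/eqP; rewrite (eq_subG_cyclic cycK) ?cycle_subG // -!orderE oy.
by rewrite -cycle_subG -eq_zy cycle_subG Kz /order eq_zy.
Qed.

(** Double counting of the pairs (d, y) where d is the order of y and P d
    holds: every order is a divisor of #|K|, and each divisor d accounts for
    totient d elements. *)
Lemma card_order_pred_cyclic (gT : finGroupType) (K : {group gT})
    (P : pred nat) :
  cyclic K ->
  #|[set y in K | P #[y]%g]| = \sum_(d <- divisors #|K| | P d) totient d.
Proof.
move=> cycK.
have dvdK d : (d \in divisors #|K|) = (d %| #|K|).
  by rewrite -dvdn_divisors ?cardG_gt0.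
transitivity (\sum_(d <- divisors #|K| | P d)
                \sum_(y | (y \in K) && (#[y]%g == d)) 1); last first.
  rewrite big_seq_cond [RHS]big_seq_cond; apply: eq_bigr => d /andP[dK _].
  by rewrite sum1dep_card card_order_eq_cyclic // -dvdK.
rewrite (exchange_big_dep (fun y => (y \in K) && P #[y]%g)) /=; last first.
  by move=> d y Pd /andP[-> /eqP->].
rewrite -sum1dep_card; apply: eq_bigr => y /andP[Ky Py].
rewrite sum1_count (eq_count (a2 := pred1 #[y]%g)); last first.
  by move=> d /=; rewrite Ky eq_sym; case: eqP => [->|]; rewrite ?Py ?andbF.
by rewrite count_uniq_mem ?divisors_uniq // dvdK order_dvdG.
Qed.

Lemma sum_Omega_cyclic (gT : finGroupType) (K : {group gT}) (h : nat) :
  cyclic K ->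
  \sum_(d <- Omega #|K| h) totient d =
  #|[set y in K | (1 < #[y]%g) && (1 < gcdn #[y]%g h)]|.
Proof.
by move=> cycK; rewrite big_filter -(card_order_pred_cyclic _ _ (fun d => _)).
Qed.

Theorem lemma2p2 (gT : finGroupType) (G H : {group gT})
  (n r : nat) (p alpha : 'I_r -> nat)
  (hcyc : cyclic G) (hcard : #|G| = n)
  (hp : forall i, prime (p i)) (hpinj : injective p)
  (hn : n = (\prod_(i < r) p i ^ alpha i)%N) (hn3 : (3 <= n)%N)
  (hHG : H \subset G) (hH1 : (H : {set gT}) <> [set 1%g])
  (x : gT) (hx : x \in G^#%g) :
  ((deg (noncoprime_graph G H) x)%:Z =
   if x \in H
   then (\sum_(d <- Omega #|G| #[x]%g) totient d)%N%:Z - 1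
   else (\sum_(d <- Omega #|H| #[x]%g) totient d)%N%:Z)%R.
Proof.
have [x_neq1 Gx] := setD1P hx.
have gcd_gt1 y : (1 < gcdn #[y]%g #[x]%g) = (gcdn #[x]%g #[y]%g != 1).
  by rewrite gcdnC ltn_neqAle gcdn_gt0 order_gt0 eq_sym andbT.
case: ifPn => [Hx | nHx].
  (* x itself satisfies the conditions on order but is not its own neighbour. *)
  rewrite sum_Omega_cyclic // (cardsD1 x) inE Gx gcdnn order_gt1 x_neq1 /=.
  rewrite PoszD GRing.addrAC GRing.subrr GRing.add0r; congr (Posz _).
  apply: eq_card => y.
  rewrite !inE /= /ncadj Hx !inE Gx x_neq1 order_gt1 gcd_gt1 /= [x == y]eq_sym.
  by case: (y == x) (y == 1%g) (y \in G) => [] [] []; rewrite ?andbF ?andbT.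
rewrite sum_Omega_cyclic ?(cyclicS hHG) //; congr (Posz _).
apply: eq_card => y.
rewrite !inE /= /ncadj (negPf nHx) !inE Gx x_neq1 order_gt1 gcd_gt1 /=.
have [Hy | nHy] := boolP (y \in H); last by rewrite !andbF.
rewrite (subsetP hHG) // (_ : x != y) ?andbT; last first.
  by apply: contraNneq nHx => ->.
by case: (y == 1%g).
Qed.
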